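(* Let $\mathcal{H}$ be a real separable Hilbert space, let $C$ be a nonempty closed convex subset of $\mathcal{H}$, let $f\in\Gamma_0(\mathcal{H})$ and let $\gamma>0$. Suppose that one of the following holds: (1) $C\cap\operatorname{int}\operatorname{dom}f\neq\varnothing$; (2) $\operatorname{dom}f\cap\operatorname{int}C\neq\varnothing$; (3) $\mathcal{H}$ is finite dimensional and $\operatorname{rint}C\cap\operatorname{rint}\operatorname{dom}f\neq\varnothing$. Let $x\in\mathcal{H}$, $\kappa>0$, let $(\tau_m)_{m\in\mathbb{N}}$ be a real sequence with $\inf_{m\in\mathbb{N}}\tau_m>0$ and $\sup_{m\in\mathbb{N}}\tau_m\le2$, let $z_0\in\mathcal{H}$ and, for every $m\in\mathbb{N}$, set $$\begin{cases}z_{m+\frac12}=P_C\Big(\dfrac{z_m+\kappa x}{1+\kappa}\Big)\\ z_{m+1}=z_m+\tau_m\big(\operatorname{prox}_{\kappa\gamma f}(2z_{m+\frac12}-z_m)-z_{m+\frac12}\big).\end{cases}$$ Then: (i) $(z_{m+\frac12})_{m\in\mathbb{N}}$ converges strongly to $\operatorname{prox}_{\iota_C+\gamma f}x$; (ii) if $\kappa=1$ and $z_0=2\operatorname{prox}_{\gamma f}x-x$, then $$\operatorname{prox}_{\gamma f}x\in C\quad\Rightarrow\quad(\forall m\in\mathbb{N})\;\;z_{m+\frac12}=\operatorname{prox}_{\iota_C+\gamma f}x.$$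
   Context: $\Gamma_0(\mathcal{H})$ denotes the class of lower semicontinuous convex functions from $\mathcal{H}$ to $]-\infty,+\infty]$ that are proper (not identically $+\infty$). $\operatorname{dom}f=\{x\mid f(x)<+\infty\}$; $\operatorname{int}S$ and $\operatorname{rint}S$ are the interior and relative interior of $S$. $\iota_C$ is the indicator function of $C$ ($0$ on $C$, $+\infty$ elsewhere), $P_C$ is the projection onto $C$, and for $h\in\Gamma_0(\mathcal{H})$, $\operatorname{prox}_h x=\arg\min_{y\in\mathcal{H}}\frac12\|y-x\|^2+h(y)$. *)

(* Defs.v *)
From HB Require Import structures.
From mathcomp Require Import all_boot all_order all_algebra.
From mathcomp Require Import all_classical all_reals all_analysis.

Set Implicit Arguments.
Unset Strict Implicit.
Unset Printing Implicit Defensive.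

Import Order.TTheory GRing.Theory Num.Theory.
Import numFieldNormedType.Exports.

Local Open Scope classical_set_scope.
Local Open Scope ring_scope.

(* A real Hilbert space is a [completeNormedModType R] together with a scalar
   product [dot : {dot H for idfun}] (bilinear, symmetric, positive definite)
   that induces the norm. *)
Definition hilbert_norm (R : realType) (H : completeNormedModType R)
    (dot : {dot H for idfun}) : Prop :=
  forall u : H, `|u| = Num.sqrt (dot u u).

Definition separable_space (T : topologicalType) : Prop :=
  exists2 D : set T, countable D & dense D.

Definition finite_dimensional (R : realType) (V : lmodType R) : Prop :=
  exists (n : nat) (e : 'I_n -> V),
    forall v : V, exists c : 'I_n -> R, v = \sum_(i < n) c i *: e i.

Definition affine_set (R : realType) (V : lmodType R) (A : set V) : Prop :=
  forall (x y : V) (t : R), A x -> A y -> A (t *: x + (1 - t) *: y).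

Definition affine_hull (R : realType) (V : lmodType R) (S : set V) : set V :=
  smallest (@affine_set R V) S.

(* Interior of [S] for the topology induced on its affine hull. *)
Definition rint (R : realType) (H : normedModType R) (S : set H) : set H :=
  [set x | S x /\ \forall y \near x, affine_hull S y -> S y].

Section ExtendedRealFunctions.
Variables (R : realType) (H : normedModType R).
Implicit Types (f h : H -> \bar R) (C : set H).
Local Open Scope ereal_scope.

Definition edom f : set H := [set x | f x < +oo].

(* Restricting [t] to ]0, 1[ loses nothing, and no [+oo - oo] can occur when
   [f] never takes the value [-oo]. *)
Definition econvex f : Prop :=
  forall (x y : H) (t : R), (0 < t)%R -> (t < 1)%R ->
    f (t *: x + (1 - t) *: y)%R <= t%:E * f x + (1 - t)%:E * f y.

Definition Gamma0 f : Prop :=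
  [/\ forall x, f x != -oo, edom f !=set0, econvex f & lower_semicontinuous f].

Definition indicator C : H -> \bar R := fun x => if x \in C then 0 else +oo.

Definition argmin h : set H := [set p | forall y, h p <= h y].

(* [prox] and [projection] select a minimiser by choice, with the conventional value
   0 when there is none; the minimiser exists and is unique as soon as [H] is a
   Hilbert space and [Gamma0 h] (resp. [C] is nonempty, closed, convex). *)
Definition prox h (x : H) : H :=
  xget 0%R (argmin (fun y => (2^-1 * `|y - x| ^+ 2)%:E + h y)).

Definition projection C (x : H) : H :=
  xget 0%R [set p | C p /\ forall y, C y -> (`|p - x| <= `|y - x|)%R].

End ExtendedRealFunctions.

(* Main.v *)
Require Import Defs.
From HB Require Import structures.
From mathcomp Require Import all_boot all_order all_algebra.
From mathcomp Require Import all_classical all_reals all_analysis.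
From mathcomp Require Import ring lra.

Set Implicit Arguments.
Unset Strict Implicit.

Import Order.TTheory GRing.Theory Num.Theory.
Import numFieldNormedType.Exports.

Local Open Scope classical_set_scope.
Local Open Scope ring_scope.

(** Write [F] for [gamma f], [i_C] for the indicator of [C], and [p] for the
    point to be reached.

    Strong convergence is cheap once [p] carries a dual certificate, that is, a
    vector [v] with [v] in the subdifferential of [F] at [p] and [x - p - v] in
    the normal cone to [C] at [p]. The recursion is the Douglas-Rachford
    iteration for the sum of the operators [d i_C + Id - x] and [dF], scaled by
    [kappa]; it has the fixed point [p - kappa v]. Monotonicity of the two
    subdifferentials, together with the strong monotonicity contributed by
    [Id - x], gives
      [|z_(m+1) - (p - kappa v)|^2 <=
         |z_m - (p - kappa v)|^2 - 2 tau_m kappa |z_(m+1/2) - p|^2]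
    as soon as [0 <= tau_m <= 2] (lemma [douglas_rachford_step]). As [tau_m] is
    bounded away from 0, the squared distances [|z_(m+1/2) - p|^2] are bounded
    by a constant times the increments of a convergent sequence, so they tend
    to 0.

    The substance is therefore the existence of the certificate, which is a
    sum rule for subdifferentials of two functions [g] and [h] ([sum_rule]),
    used with [g = i_C] and [h = F]. It is obtained by regularisation. For
    [l > 0] a fixed point of a contraction provides [a] and [v] with
    [x - a - v] in [dg(a)] and [v] in [dh(a - l v)] ([yosida_solution]). As in
    the work of Brezis, Crandall and Pazy, monotonicity yields
      [l |v|^2 + l' |v'|^2 <= (l + l') <v, v'>]
    for two values [l] and [l'] of the parameter, hence
    [|v - v'|^2 <= |v'|^2 - |v|^2] when [l' < l]. So boundedness of the [v]'s
    alone forces them to converge strongly when [l] tends to 0, and then so do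
    the [a]'s; subdifferentials having closed graphs, the limits are the
    required pair. Boundedness is where the qualification condition enters:
    comparing values at [c] in [dom g] and [d] in [dom h] bounds [<v, d - c>]
    from above independently of [l], and the three conditions of the theorem
    all imply that these differences [d - c] absorb every direction that the
    [v]'s can see ([absorbing]). The uniform boundedness principle concludes.

    Part (ii) is a direct computation: [q = prox_F x] lying in [C] is also the
    proximal point for [i_C + F], and the given [z_0] is a fixed point of the
    recursion with [z_(1/2) = P_C q = q]. *)

(** * Algebra of the scalar product *)

Section InnerProduct.
Context (R : realType) (H : completeNormedModType R) (dot : {dot H for idfun}).
Implicit Types u v w : H.

Lemma dotC u v : dot u v = dot v u.
Proof. by rewrite hermC /= expr0 mul1r. Qed.

Lemma dotDl u v w : dot (u + v) w = dot u w + dot v w.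
Proof. exact: linearDl. Qed.

Lemma dotNl u w : dot (- u) w = - dot u w.
Proof. exact: linearNl. Qed.

Lemma dotZl (a : R) u w : dot (a *: u) w = a * dot u w.
Proof. exact: linearZl_LR. Qed.

Lemma dotDr u v w : dot w (u + v) = dot w u + dot w v.
Proof. exact: linearDr. Qed.

Lemma dotNr u w : dot w (- u) = - dot w u.
Proof. exact: linearNr. Qed.

Lemma dotZr (a : R) u w : dot w (a *: u) = a * dot w u.
Proof. by rewrite dotC dotZl dotC. Qed.

Lemma dot0l w : dot 0 w = 0.
Proof. exact: linear0l. Qed.

Lemma dot0r w : dot w 0 = 0.
Proof. exact: linear0r. Qed.

Definition dotE := (dotDl, dotDr, dotNl, dotNr, dotZl, dotZr).

Lemma dot_ge0 u : 0 <= dot u u.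
Proof.
have [->|u0] := eqVneq u 0; first by rewrite dot0l.
by apply/ltW/neq0_dnorm_gt0.
Qed.

Hypothesis hdot : hilbert_norm dot.

Lemma sqnormE u : `|u| ^+ 2 = dot u u.
Proof. by rewrite hdot sqr_sqrtr ?dot_ge0. Qed.

Lemma dot_le u v : dot u v <= `|u| * `|v|.
Proof.
have : `|u + v| ^+ 2 <= (`|u| + `|v|) ^+ 2.
  by rewrite lerXn2r ?nnegrE ?addr_ge0 ?ler_normD.
by rewrite sqrrD !sqnormE !dotE (dotC v u); lra.
Qed.

(** Identities between vectors are proved by testing them against an arbitrary
    vector, which makes them identities in the field of scalars. *)
Lemma dot_ext u v : (forall w, dot u w = dot v w) -> u = v.
Proof.
move=> uv; apply/eqP; rewrite -subr_eq0 -normr_eq0 -sqrf_eq0 sqnormE.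
by rewrite dotDl dotNl uv subrr.
Qed.

Lemma cvg_dot (u w : nat -> H) (u0 w0 : H) :
  u n @[n --> \oo] --> u0 -> w n @[n --> \oo] --> w0 ->
  dot (u n) (w n) @[n --> \oo] --> dot u0 w0.
Proof.
move=> uu ww.
(* Polarisation reduces the claim to continuity of the norm. *)
have polar (a b : H) : dot a b = 2^-1 * (`|a + b| * `|a + b| - `|a| * `|a| - `|b| * `|b|).
  by rewrite -!expr2 !sqnormE !dotE (dotC b); field.
rewrite polar; under eq_fun do rewrite polar.
apply: cvgM; first exact: cvg_cst.
by apply: cvgB; [apply: cvgB|]; apply: cvgM; apply: cvg_norm => //; apply: cvgD.
Qed.

End InnerProduct.

(** * Lower semicontinuous convex functions *)

Section LowerSemicontinuity.
Context (R : realType) (H : completeNormedModType R).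
Implicit Types (h : H -> \bar R).

Lemma lsc_cvg_le h (u : nat -> H) (p : H) (M : nat -> R) (l : R) :
  lower_semicontinuous h -> u n @[n --> \oo] --> p -> M n @[n --> \oo] --> l ->
  (forall n, (h (u n) <= (M n)%:E)%E) -> (h p <= l%:E)%E.
Proof.
move=> lsch up Ml hM; rewrite leNgt; apply/negP => lhp.
have [a la ahp] : exists2 a : R, l < a & (a%:E < h p)%E.
  case: (h p) lhp => [r||] //.
    rewrite lte_fin => lr; exists ((l + r) / 2); first by lra.
    by rewrite lte_fin; lra.
  by move=> _; exists (l + 1); rewrite ?ltry //; lra.
have [V nV Va] := lsch _ _ ahp.
have : \forall n \near \oo, False.
  near=> n.
  have : M n < a by near: n; exact: (cvgr_lt l Ml).
  have : (a%:E < h (u n))%E by apply: Va; near: n; exact: up.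
  move=> /lt_le_trans/(_ (hM n)); rewrite lte_fin => /lt_trans /[apply].
  by rewrite ltxx.
by case=> N _ /(_ N) /=; apply.
Unshelve. all: by end_near. Qed.

(** The form in which strong convexity and monotonicity deliver Cauchy
    sequences: a bound on squared distances that splits into two null terms. *)
Lemma cvg_of_sqdist (u : nat -> H) (e : nat -> R) :
  e n @[n --> \oo] --> (0 : R) ->
  (forall n k, `|u n - u k| ^+ 2 <= e n + e k) -> cvgn u.
Proof.
move=> e0 ue; apply/cauchy_cvgP/cauchy_ballP => eps eps0; near_simpl.
have eps2 : 0 < eps ^+ 2 / 2 by rewrite divr_gt0 ?exprn_gt0.
have [N _ Ne] := cvgr_lt _ e0 _ eps2.
exists ([set n | N <= n]%N, [set n | N <= n]%N).
  by split; exists N.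
move=> [n k] /= [Nn Nk].
rewrite -ball_normE /ball_ /=.
rewrite -(@ltr_pXn2r _ 2) ?nnegrE ?normr_ge0 ?(ltW eps0)//.
apply: le_lt_trans (ue n k) _.
by have := Ne _ Nn; have := Ne _ Nk => /=; lra.
Qed.

Lemma Gamma0_finite h x : Gamma0 h -> (h x < +oo)%E -> exists r, h x = r%:E.
Proof. by move=> [hN _ _ _]; have := hN x; case: (h x) => // r; exists r. Qed.

(** Lower semicontinuity at one point [y0] of the domain bounds [h] from below on
    a ball around [y0]. Any [y] is pulled into that ball along the segment
    [y0, y], and convexity transports the bound back, at a cost linear in the
    distance. *)
Lemma Gamma0_minorant h : Gamma0 h ->
  exists2 K : R, 0 <= K & forall y r, h y = r%:E -> - (K * (1 + `|y|)) <= r.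
Proof.
move=> Gh; have [hN [y0 /(Gamma0_finite Gh)[r0 hy0]] cvx lsc] := Gh.
have [V /nbhs_ballP[d /= d0 dV] Va] : exists2 V, nbhs y0 V &
    forall y, V y -> ((r0 - 1)%:E < h y)%E.
  by apply: lsc; rewrite hy0 lte_fin; lra.
pose K := `|r0| + 2 + 2 * (`|y0| + 1) / d.
have dV0 : 0 <= 2 * (`|y0| + 1) / d by rewrite !mulr_ge0 ?invr_ge0 ?ltW// addr_ge0.
exists K; first by rewrite /K !addr_ge0.
move=> y r hy; set q := `|y - y0|.
have q0 : 0 <= q by exact: normr_ge0.
(* The choice [t q < d] puts [t y + (1 - t) y0] in the ball, whatever [q] is. *)
pose t := d / (2 * (q + d)).
have t0 : 0 < t by rewrite divr_gt0 // mulr_gt0 // ltr_wpDl.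
have qd0 : 0 < q + d by rewrite ltr_wpDl.
have tE : t * (2 * (q + d)) = d by rewrite /t divfK // gt_eqF // mulr_gt0.
have t1 : t < 1 by rewrite /t ltr_pdivrMr ?mulr_gt0//; lra.
have := cvx y y0 t t0 t1.
have /Va : V (t *: y + (1 - t) *: y0).
  apply: dV; rewrite -ball_normE /ball_ /=.
  have -> : y0 - (t *: y + (1 - t) *: y0) = - (t *: (y - y0)).
    by rewrite scalerBl scale1r scalerBr opprD !opprB [LHS]addrC -!addrA addNr addr0 addrC.
  rewrite normrN normrZ gtr0_norm // -/q.
  by have := mulr_ge0 (ltW t0) q0; have := mulr_gt0 t0 d0; lra.
move=> /lt_le_trans/[apply]; rewrite hy hy0 -!EFinM -EFinD lte_fin => lt1.
have tV : t^-1 = 2 * q / d + 2.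
  by rewrite /t invf_div; field; rewrite gt_eqF.
have : - t^-1 <= r - r0.
  rewrite -(ler_pM2l t0) mulrN mulfV ?gt_eqF//; lra.
rewrite tV => le1.
have qle : q <= `|y| + `|y0| by exact: ler_normB.
have : 2 * q / d <= 2 * (`|y| + `|y0|) / d.
  by rewrite ler_pM2r ?invr_gt0// ler_pM2l.
have E1 : 2 * (`|y| + `|y0|) / d = 2 * `|y| / d + 2 * `|y0| / d by field; rewrite gt_eqF.
have E2 : K = `|r0| + 2 + 2 * `|y0| / d + 2 / d.
  by rewrite /K; field; rewrite gt_eqF.
have y00 := normr_ge0 y; have r00 := normr_ge0 r0; have := ler_norm (- r0).
rewrite normrN => r0l.
have A : 0 <= (`|r0| + 2 + 2 * `|y0| / d) * `|y|.
  by rewrite mulr_ge0 // !addr_ge0 ?mulr_ge0 ?invr_ge0 // ltW.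
have B : 2 / d * `|y| = 2 * `|y| / d by field; rewrite gt_eqF.
have Cd : 0 <= 2 / d by rewrite mulr_ge0 ?invr_ge0 ?ltW.
by rewrite E2; move: le1; rewrite E1; nra.
Qed.

End LowerSemicontinuity.

(** * Subgradients and proximal points *)

Section Prox.
Context (R : realType) (H : completeNormedModType R) (dot : {dot H for idfun}).
Hypothesis hdot : hilbert_norm dot.
Implicit Types (h g : H -> \bar R) (x y p u v : H).

(** The objective is bounded below because the quadratic term beats the linear
    minorant of [h]. By the parallelogram identity its minimising sequences are
    Cauchy, and their limit is a minimiser by lower semicontinuity. *)
Lemma prox_exists h x : Gamma0 h ->
  argmin (fun y => (2^-1 * `|y - x| ^+ 2)%:E + h y)%E !=set0.
Proof.
move=> Gh; have [hN [y0 /(Gamma0_finite Gh)[r0 hy0]] cvx lsc] := Gh.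
have [K K0 hK] := Gamma0_minorant Gh.
pose S : set R := [set s | exists2 y, exists r, h y = r%:E &
  s = 2^-1 * `|y - x| ^+ 2 + fine (h y)].
have infS : has_inf S.
  split; first by exists (2^-1 * `|y0 - x| ^+ 2 + fine (h y0)), y0 => //; exists r0.
  exists (- (K ^+ 2 / 2) - K * (1 + `|x|)) => _ [y [r hy] ->]; rewrite hy /=.
  have : `|y| <= `|y - x| + `|x| by rewrite -{1}(subrK x y) ler_normD.
  move=> /(ler_wpM2l K0); have := hK _ _ hy; have := sqr_ge0 (`|y - x| - K).
  by rewrite sqrrB; lra.
have ml s : S s -> inf S <= s by move=> Ss; apply: ge_inf => //; case: infS.
pose e (n : nat) : R := n.+1%:R^-1.
have e_gt0 n : 0 < e n by rewrite invr_gt0.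
have /choice[w hw] : forall n, exists yr : H * R, h yr.1 = yr.2%:E /\
    2^-1 * `|yr.1 - x| ^+ 2 + yr.2 < inf S + e n.
  move=> n; have [_ [y [r hy] ->] lt] := inf_adherent (e_gt0 n) infS.
  by exists (y, r); split=> //; move: lt; rewrite hy.
have hy n : h (w n).1 = (w n).2%:E by have [] := hw n.
have Fe n : 2^-1 * `|(w n).1 - x| ^+ 2 + (w n).2 < inf S + e n by have [] := hw n.
have e0 : e n @[n --> \oo] --> (0 : R) by exact: cvg_harmonic.
have /cvg_ex[p wp] : cvgn (fun n => (w n).1).
  apply: (@cvg_of_sqdist _ _ _ (fun n => 4 * e n)).
    by rewrite -(mulr0 (4 : R)); apply: cvgM => //; exact: cvg_cst.
  (* The value at the midpoint of two terms is at least the infimum, while strong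
     convexity makes it smaller than the average by an eighth of the squared
     distance. *)
  move=> n k; set y := (w n).1; set y' := (w k).1.
  have t1 : 2^-1 < 1 :> R by lra.
  have t0 : 0 < 2^-1 :> R by lra.
  have := cvx y y' _ t0 t1; rewrite !hy -!EFinM -EFinD.
  set mid := _ + _ => le1.
  have [r hm] : exists r, h mid = r%:E.
    by apply: (Gamma0_finite Gh); apply: le_lt_trans le1 (ltry _).
  move: le1; rewrite hm lee_fin => le1.
  have : inf S <= 2^-1 * `|mid - x| ^+ 2 + r.
    by apply: ml; exists mid; [exists r | rewrite hm].
  have := Fe n; have := Fe k; rewrite -/y -/y' !(sqnormE hdot) /mid !dotE.
  by rewrite (dotC dot x y) (dotC dot x y') (dotC dot y' y); lra.
have hp : (h p <= (inf S - 2^-1 * `|p - x| ^+ 2)%:E)%E.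
  apply: (lsc_cvg_le lsc wp (M := fun n => inf S + e n - 2^-1 * `|(w n).1 - x| ^+ 2)).
    apply: cvgB.
      by rewrite -[X in _ --> X]addr0; apply: cvgD => //; exact: cvg_cst.
    apply: cvgM; first exact: cvg_cst.
    rewrite expr2; under eq_fun do rewrite expr2.
    by apply: cvgM; apply: cvg_norm; apply: cvgB => //; exact: cvg_cst.
  by move=> n; rewrite hy lee_fin; have := Fe n; lra.
exists p => y; have [r hpr] := Gamma0_finite Gh (le_lt_trans hp (ltry _)).
case hyE : (h y) => [s||]; last by have := hN y; rewrite hyE.
  rewrite hpr -!EFinD lee_fin; move: hp; rewrite hpr lee_fin.
  have : inf S <= 2^-1 * `|y - x| ^+ 2 + s by apply: ml; exists y; [exists s|rewrite hyE].
  by lra.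
by rewrite addey ?leey.
Qed.

Definition subgradient h p v :=
  h p \is a fin_num /\ forall y, ((fine (h p) + dot v (y - p))%:E <= h y)%E.

Lemma subgradient_le h p v y s : subgradient h p v -> h y = s%:E ->
  fine (h p) + dot v (y - p) <= s.
Proof. by move=> [_ /(_ y)] + hy; rewrite hy lee_fin. Qed.

Lemma subgradient_fin h p v : subgradient h p v -> exists r, h p = r%:E.
Proof. by move=> [/fineK hp _]; exists (fine (h p)). Qed.

(** Fermat's rule. The minimality of [p] is tested along the segment from [p] to
    [y]; the quadratic term contributes only at second order, so it disappears
    when the step [t] is small. *)
Lemma prox_subgradient h x : Gamma0 h -> subgradient h (prox h x) (x - prox h x).
Proof.
move=> Gh; have [hN [y0 /(Gamma0_finite Gh)[r0 hy0]] cvx _] := Gh.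
have [q0 q0min] := prox_exists x Gh.
have : argmin (fun y => (2^-1 * `|y - x| ^+ 2)%:E + h y)%E (prox h x) by exact: xgetI q0min.
move: (prox h x) => p pmin.
have [r hp] : exists r, h p = r%:E.
  have := pmin y0; rewrite hy0; have := hN p; case: (h p) => [r||] // _; first by exists r.
split; rewrite hp // => y /=.
case hy : (h y) => [s||]; [|by rewrite leey|by have := hN y; rewrite hy].
rewrite lee_fin; apply/ler_addgt0Pr => eps eps0.
set q := `|y - p| ^+ 2.
have q_ge0 : 0 <= q by rewrite exprn_ge0.
(* A step in the open unit interval with [t * q <= eps]. *)
pose t := eps / (eps + q + 1).
have den0 : 0 < eps + q + 1 by lra.
have t0 : 0 < t by rewrite divr_gt0.
have t1 : t < 1 by rewrite ltr_pdivrMr //; lra.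
have tq : t * q <= eps.
  by rewrite /t mulrAC ler_pdivrMr // ler_pM2l //; lra.
have := cvx y p t t0 t1; rewrite hy hp -!EFinM -EFinD.
set z := _ + _ => hz.
have [a hza] : exists a, h z = a%:E.
  by apply: (Gamma0_finite Gh); exact: le_lt_trans hz (ltry _).
move: hz; rewrite hza lee_fin => hz.
have := pmin z; rewrite hp hza -!EFinD lee_fin.
have -> : z - x = (p - x) + t *: (y - p).
  by apply: (dot_ext hdot) => w; rewrite /z !dotE; ring.
rewrite /q !(sqnormE hdot) in tq *.
have -> : x - p = - (p - x) by rewrite opprB.
rewrite dotNl; move: (p - x) (y - p) tq => a' d tq.
rewrite !dotE (dotC dot d) => le1.
rewrite -(ler_pM2l t0); nra.
Qed.

(** Strong convexity: the subgradient inequality shows that the objective at [y]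
    exceeds its value at [p] by [|y - p|^2 / 2], so [p] is the only minimiser. *)
Lemma subgradient_argmin h x p : subgradient h p (x - p) ->
  argmin (fun y => (2^-1 * `|y - x| ^+ 2)%:E + h y)%E = [set p].
Proof.
move=> sub; have [r hp] := subgradient_fin sub.
have key y s : h y = s%:E -> 2^-1 * `|p - x| ^+ 2 + r + 2^-1 * `|y - p| ^+ 2
    <= 2^-1 * `|y - x| ^+ 2 + s.
  move=> /(subgradient_le sub); rewrite hp /= !(sqnormE hdot).
  have -> : y - x = (y - p) - (x - p) by apply: (dot_ext hdot) => w; rewrite !dotE; ring.
  have -> : p - x = - (x - p) by rewrite opprB.
  move: (x - p) (y - p) => a d.
  by rewrite !dotE (dotC dot d); lra.
apply/seteqP; split=> [y ymin|_ -> y] /=.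
- have := ymin p; have [_ /(_ y)] := sub.
  rewrite hp; case hy : (h y) => [s||] //= _; rewrite -?EFinD ?lee_fin.
  move=> le1; have le2 := key _ _ hy.
  apply/eqP; rewrite -subr_eq0 -normr_eq0 -sqrf_eq0 eq_le sqr_ge0 andbT; lra.
- rewrite hp; have [_ /(_ y)] := sub.
  case hy : (h y) => [s||] //= _; last by rewrite addey ?leey.
  by rewrite lee_fin; have := key _ _ hy; have := sqr_ge0 `|y - p|; lra.
Qed.

Lemma subgradient_prox h x p : subgradient h p (x - p) -> prox h x = p.
Proof. by move=> /subgradient_argmin E; rewrite /prox E; have /= := xgetI 0 (erefl p : [set p] p). Qed.

Lemma subgradient_monotone h p q u v : subgradient h p u -> subgradient h q v ->
  0 <= dot (u - v) (p - q).
Proof.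
move=> su sv; have [r hp] := subgradient_fin su; have [s hq] := subgradient_fin sv.
have := subgradient_le su hq; have := subgradient_le sv hp; rewrite hp hq /=.
by rewrite !dotE; lra.
Qed.

(** Monotonicity makes [prox h] firmly nonexpansive, and Cauchy-Schwarz concludes. *)
Lemma prox_nonexpansive h x y : Gamma0 h -> `|prox h x - prox h y| <= `|x - y|.
Proof.
move=> Gh.
have := subgradient_monotone (prox_subgradient x Gh) (prox_subgradient y Gh).
move: (prox h x) (prox h y) => p q mono.
have le1 : `|p - q| ^+ 2 <= `|x - y| * `|p - q|.
  apply: le_trans (dot_le hdot _ _); rewrite (sqnormE hdot).
  by move: mono; rewrite !dotE; lra.
have [->|pq0] := eqVneq (`|p - q|) 0; first exact: normr_ge0.
by move: le1; rewrite expr2 ler_pM2r // lt_def pq0 normr_ge0.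
Qed.

Lemma Gamma0_scale h (c : R) : 0 < c -> Gamma0 h -> Gamma0 (fun y => c%:E * h y)%E.
Proof.
move=> c0 Gh; have [hN [y0 /(Gamma0_finite Gh)[r0 hy0]] cvx lsc] := Gh.
split.
- move=> y; have := hN y; case: (h y) => [r||] // _.
  by rewrite gt0_muley // lte_fin.
- by exists y0; rewrite /edom /= hy0 -EFinM ltry.
- move=> x y t t0 t1; have := cvx x y t t0 t1.
  rewrite -(@lee_pmul2l _ c%:E) ?lte_fin // => /le_trans; apply.
  rewrite muleDr ?muleA //; last first.
    have := hN x; have := hN y; have t10 : 0 < 1 - t by lra.
    by case: (h x) => [r||] //; case: (h y) => [s||] // _ _;
      rewrite ?gt0_muley ?lte_fin // -?EFinM.
  by rewrite muleAC (muleAC c%:E) -!muleA !(muleCA c%:E).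
- move=> x a; rewrite -lte_pdivrMl // => /lsc [V nV Va].
  by exists V => // y /Va; rewrite -lte_pdivrMl.
Qed.

Lemma subgradient_scale h (c : R) p v : 0 < c ->
  subgradient h p v <-> subgradient (fun y => c%:E * h y)%E p (c *: v).
Proof.
move=> c0; split=> -[hp sub].
  split; first by rewrite fin_numM.
  move=> y; rewrite fineM //= dotZl -mulrDr EFinM lee_pmul2l ?lte_fin //.
have hp' : h p \is a fin_num.
  move: hp; case: (h p) => [r||] //; first by rewrite gt0_muley ?lte_fin.
  by rewrite gt0_muleNy ?lte_fin.
split=> // y; have := sub y.
by rewrite fineM //= dotZl -mulrDr EFinM lee_pmul2l ?lte_fin.
Qed.

Lemma subgradientD g h p u v : subgradient g p u -> subgradient h p v ->
  subgradient (fun y => g y + h y)%E p (u + v).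
Proof.
move=> [gp su] [hp sv]; split=> [|y]; first by rewrite fin_numD gp.
by rewrite fineD // dotDl addrACA EFinD leeD.
Qed.

Lemma subgradient_dom h p v : subgradient h p v -> edom h p.
Proof. by move=> /subgradient_fin[r hp]; rewrite /edom /= hp ltry. Qed.

(** The graph of a subdifferential is closed: each instance of the subgradient
    inequality passes to the limit by lower semicontinuity. *)
Lemma subgradient_closed h (q u : nat -> H) (q0 u0 : H) : Gamma0 h ->
  q n @[n --> \oo] --> q0 -> u n @[n --> \oo] --> u0 ->
  (forall n, subgradient h (q n) (u n)) -> subgradient h q0 u0.
Proof.
move=> Gh qq uu sub; have [hN [y0 /(Gamma0_finite Gh)[r0 hy0]] _ lsc] := Gh.
have key y s : h y = s%:E -> (h q0 <= (s - dot u0 (y - q0))%:E)%E.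
  move=> hy; apply: (lsc_cvg_le lsc qq (M := fun n => s - dot (u n) (y - q n))).
    apply: cvgB; first exact: cvg_cst.
    by apply: (cvg_dot hdot) => //; apply: cvgB => //; exact: cvg_cst.
  move=> n; have [r hq] := subgradient_fin (sub n).
  by have := subgradient_le (sub n) hy; rewrite hq lee_fin /=; lra.
have [r hq] := Gamma0_finite Gh (le_lt_trans (key _ _ hy0) (ltry _)).
split=> [|y]; first by rewrite hq.
rewrite hq /=; case hy : (h y) => [s||]; [|by rewrite leey|by have := hN y; rewrite hy].
by have := key _ _ hy; rewrite hq !lee_fin; lra.
Qed.

End Prox.

(** * Indicator functions and projections *)

Section Indicator.
Context (R : realType) (H : completeNormedModType R) (dot : {dot H for idfun}).
Hypothesis hdot : hilbert_norm dot.
Implicit Types (h g : H -> \bar R) (x y p u v : H).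
Local Notation subgradient := (subgradient dot).

Lemma indicator_in (C : set H) y : C y -> indicator (R := R) C y = 0%E.
Proof. by move=> Cy; rewrite /indicator mem_set. Qed.

Lemma indicator_notin (C : set H) y : ~ C y -> indicator (R := R) C y = +oo%E.
Proof. by move=> Cy; rewrite /indicator memNset. Qed.

Lemma edom_indicator (C : set H) : edom (indicator (R := R) C) = C.
Proof.
apply/seteqP; split=> y; rewrite /edom /indicator /=.
  by case: ifPn => [/set_mem|_].
by move=> Cy; rewrite mem_set ?ltry.
Qed.

Lemma indicator_scale (C : set H) (c : R) : 0 < c ->
  (fun y => c%:E * indicator C y)%E = indicator C.
Proof.
move=> c0; apply/funext => y; rewrite /indicator; case: ifP => _; first by rewrite mule0.
by rewrite gt0_muley ?lte_fin.
Qed.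

Lemma Gamma0_indicator (C : set H) : C !=set0 -> closed C -> convex_set C ->
  Gamma0 (indicator (R := R) C).
Proof.
move=> [c Cc] Ccl Ccvx; split.
- by move=> x; rewrite /indicator; case: ifP.
- by exists c; rewrite /edom /indicator /= mem_set // ltry.
- move=> x y t t0 t1.
  have t10 : 0 < 1 - t by lra.
  have kN (k : R) z : 0 < k -> (k%:E * indicator C z != -oo)%E.
    by move=> k0; rewrite /indicator; case: ifP => _; rewrite ?mule0 ?gt0_muley ?lte_fin.
  case: (boolP (x \in C)) => xC; last first.
    rewrite [X in (_ <= _ * X + _)%E]/indicator (negbTE xC).
    by rewrite gt0_muley ?lte_fin // addye ?leey ?kN.
  case: (boolP (y \in C)) => yC; last first.
    rewrite [X in (_ <= _ + _ * X)%E]/indicator (negbTE yC).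
    by rewrite (gt0_muley (x := (1 - t)%:E)) ?lte_fin // addey ?leey ?kN.
  have := Ccvx x y (Itv01 (ltW t0) (ltW t1)) xC yC.
  rewrite /indicator xC yC !mule0 adde0.
  rewrite /conv /=.
  by case: ifP => // + zC; rewrite zC.
- move=> x a; rewrite /indicator; case: ifPn => xC ax.
    by exists setT; [exact: filterT|move=> y _; case: ifP; rewrite ?ltry].
  exists (~` C).
    by apply: open_nbhs_nbhs; split; [exact: closed_openC|move=> /mem_set; apply/negP].
  by move=> y /= Cy; rewrite memNset // ltry.
Qed.

(** Subgradients of an indicator are the normal vectors to the set. *)
Lemma subgradient_indicatorP (C : set H) p v :
  subgradient (indicator C) p v <-> C p /\ forall y, C y -> dot v (y - p) <= 0.
Proof.
split=> [[pfin sub]|[Cp sub]].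
  have Cp : C p by apply: contrapT => /indicator_notin E; rewrite E in pfin.
  split=> // y Cy; have := sub y; rewrite !indicator_in //= add0r lee_fin //.
split=> [|y]; first by rewrite indicator_in.
rewrite (indicator_in (y := p)) //= add0r; have [Cy|nCy] := pselect (C y).
  by rewrite indicator_in // lee_fin sub.
by rewrite indicator_notin // leey.
Qed.

Lemma projection_prox (C : set H) x : C !=set0 ->
  projection C x = prox (indicator C) x.
Proof.
move=> [c Cc]; rewrite /projection /prox; congr xget.
have sq (a b : H) : (2^-1 * `|a| ^+ 2 <= 2^-1 * `|b| ^+ 2) = (`|a| <= `|b|).
  by rewrite ler_pM2l ?invr_gt0 // ler_pXn2r ?nnegrE.
apply/seteqP; split=> p /=.
  move=> [Cp pmin] y; rewrite (indicator_in (y := p)) // adde0; have [Cy|nCy] := pselect (C y).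
    by rewrite indicator_in // adde0 lee_fin sq pmin.
  by rewrite indicator_notin // addey ?leey.
move=> pmin; have Cp : C p.
  by apply: contrapT => /indicator_notin E; have := pmin c; rewrite E indicator_in // addey.
split=> // y Cy; have := pmin y; rewrite !indicator_in // !adde0 lee_fin sq //.
Qed.

End Indicator.

(** * The sum rule for subdifferentials *)

Section SumRule.
Context (R : realType) (H : completeNormedModType R) (dot : {dot H for idfun}).
Hypothesis hdot : hilbert_norm dot.
Implicit Types (h g : H -> \bar R) (x y p u v : H).
Local Notation subgradient := (subgradient dot).

(** Replacing [h] by its Moreau envelope of parameter [l] always permits to solve
    the regularised inclusion: [a] is the fixed point of the composition of two
    nonexpansive proximal maps with a homothety of ratio [1 / (1 + l)], which
    comes from the strong convexity of the squared distance to [x], and [v] is the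
    gradient of the envelope at [a]. *)
Lemma yosida_solution g h x (l : R) : 0 < l -> Gamma0 g -> Gamma0 h ->
  exists a v, subgradient g a (x - a - v) /\ subgradient h (a - l *: v) v.
Proof.
move=> l0 Gg Gh.
pose m := l / (1 + l).
have l10 : 0 < 1 + l by lra.
have m0 : 0 < m by rewrite divr_gt0.
have Glh := Gamma0_scale l0 Gh; have Gmg := Gamma0_scale m0 Gg.
pose P := prox (fun y => l%:E * h y)%E.
pose Q := prox (fun y => m%:E * g y)%E.
pose T a := Q (m *: (x + l^-1 *: P a)).
have q0 : 0 <= (1 + l)^-1 by rewrite invr_ge0 ltW.
have TU : {homo T : a / [set: H] a >-> [set: H] a} by [].
have [a _ Ta] : exists2 a, [set: H] a & a = T a.
  pose Tf : {fun [set: H] >-> [set: H]} := HB.pack T (isFun.Build _ _ _ _ T TU).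
  apply: (@banach_fixed_point _ _ _ Tf); [|exact: closedT|by exists 0].
  exists (NngNum q0); split.
    by rewrite /= invf_lt1 //; lra.
  move=> [a b] _ /=; apply: le_trans (prox_nonexpansive hdot _ _ Gmg) _.
  rewrite -scalerBr opprD addrACA subrr add0r -scalerBr scalerA normrZ.
  have -> : m * l^-1 = (1 + l)^-1 by rewrite /m; field; rewrite !gt_eqF.
  rewrite ger0_norm // ler_wpM2l //.
  exact: prox_nonexpansive.
exists a, (l^-1 *: (a - P a)).
have lK : l *: (l^-1 *: (a - P a)) = a - P a by rewrite scalerA mulfV ?gt_eqF ?scale1r.
split.
  apply/(subgradient_scale dot g a _ m0).
  have := prox_subgradient hdot (m *: (x + l^-1 *: P a)) Gmg.
  rewrite -/Q -/(T a) -Ta.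
  congr (subgradient _ _ _).
  apply: (dot_ext hdot) => w; rewrite !dotE /m; field.
  by rewrite !gt_eqF.
have -> : a - l *: (l^-1 *: (a - P a)) = P a by rewrite lK subKr.
apply/(subgradient_scale dot h _ _ l0); rewrite lK.
exact: prox_subgradient.
Qed.

(** Adding the subgradient inequalities at [c] and [d] bounds [dot v (d - c)] by
    the values of [g] and [h] there, minus the values at [a] and [a - l v], minus
    a quadratic in [|a|] and [l |v|^2]. These negative quadratic terms absorb the
    linear growth allowed by the minorants, which makes the bound uniform in [a],
    [v] and [l]. *)
Lemma yosida_bound g h x c d : Gamma0 g -> Gamma0 h -> edom g c -> edom h d ->
  exists M : R, forall l a v, 0 < l -> l <= 1 ->
    subgradient g a (x - a - v) -> subgradient h (a - l *: v) v ->
    dot v (d - c) <= M.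
Proof.
move=> Gg Gh /(Gamma0_finite Gg)[gc gcE] /(Gamma0_finite Gh)[hd hdE].
have [K K0 hK] := Gamma0_minorant Gh; have [L L0 gL] := Gamma0_minorant Gg.
(* [B] is the total coefficient of [|a|] in the linear terms; completing the
   square in [|a|] produces [B ^ 2 / 4], and completing it in [|v|] produces
   [l K ^ 2 / 4], at most [K ^ 2 / 4] as [l <= 1]. *)
pose B := K + L + `|x + c|.
exists (hd + gc + K + L + K ^+ 2 / 4 + `|x| * `|c| + B ^+ 2 / 4).
move=> l a v l0 l1 sg sh.
have [ga gaE] := subgradient_fin sg; have [hb hbE] := subgradient_fin sh.
have := subgradient_le sg gcE; have := subgradient_le sh hdE.
rewrite gaE hbE /= => le1 le2.
have := hK _ _ hbE; have := gL _ _ gaE => le3 le4.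
have nb : `|a - l *: v| <= `|a| + l * `|v|.
  by apply: le_trans (ler_normB _ _) _; rewrite normrZ gtr0_norm.
have {nb} le5 : - (K * (1 + (`|a| + l * `|v|))) <= hb.
  by apply: le_trans le4; rewrite lerN2 ler_wpM2l // lerD2l.
have le6 : K * (l * `|v|) <= l * `|v| ^+ 2 + K ^+ 2 / 4.
  have : l * 0 <= l * (`|v| - K / 2) ^+ 2 by rewrite ler_pM2l ?sqr_ge0.
  have : l * K ^+ 2 <= 1 * K ^+ 2 by rewrite ler_wpM2r ?sqr_ge0.
  by rewrite !expr2; nra.
have le7 : dot (x + c) a <= `|x + c| * `|a| by exact: (dot_le hdot).
have le8 : - (`|x| * `|c|) <= dot x c.
  by rewrite lerNl -dotNl -(normrN x) (dot_le hdot).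
have := sqr_ge0 (`|a| - B / 2).
have -> : (`|a| - B / 2) ^+ 2 = `|a| ^+ 2 - B * `|a| + B ^+ 2 / 4 by field.
rewrite {1}/B !(sqnormE hdot) in le6 *.
move: le1 le2 le7; rewrite !dotE ?(dotC dot a x) ?(dotC dot c x) ?(dotC dot c a) ?(dotC dot v a).
by lra.
Qed.

(** A common form of the three qualification conditions. When 0 is interior to
    [B - A], every direction has a positive multiple in [B - A]. The orthogonality
    clause weakens this to cover relative interiors: the vectors [v] to be bounded
    are multiples of elements of [A - B], so only the component of [w] along
    [A - B] matters to them. *)
Definition absorbing (A B : set H) := forall w, exists t c d,
  [/\ 0 < t, A c, B d & forall a b, A a -> B b ->
    dot (a - b) (t *: w - (d - c)) = 0].

(** The uniform boundedness principle for the functionals [dot (v n)]; the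
    one-sided bounds at [w] and [- w] combine into a bound on absolute values. *)
Lemma dot_bounded (v : nat -> H) :
  (forall w, exists M, forall n, dot (v n) w <= M) ->
  exists M, forall n, `|v n| <= M.
Proof.
move=> bv.
pose F : set (H -> R^o) := [set f | exists n, f = dot (v n)].
have [|w|M hM] := @Banach_Steinhauss R H R^o F _ _ 1.
- move=> _ [n ->]; split; last by move=> k a b; rewrite dotDr dotZr.
  move=> r; exists (`|v n| * `|r|) => y yr.
  have yr' : `|v n| * `|y| <= `|v n| * `|r|.
    by rewrite ler_wpM2l // (le_trans yr) // ler_norm.
  rewrite ler_norml (le_trans (dot_le hdot _ _)) // andbT lerNl -dotNl.
  by rewrite (le_trans (dot_le hdot _ _)) // normrN.
- have [M hM] := bv w; have [M' hM'] := bv (- w).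
  exists (`|M| + `|M'|) => _ [n ->].
  have := hM n; have := hM' n; rewrite dotNr.
  by rewrite ler_norml => *; have := ler_norm M; have := ler_norm M';
     have := normr_ge0 M; have := normr_ge0 M'; move=> *; apply/andP; split; lra.
exists `|M| => n; have [->|v0] := eqVneq (v n) 0; first by rewrite normr0.
have nv : 0 < `|v n| by rewrite normr_gt0.
have := hM (dot (v n)) (ex_intro _ n erefl) (`|v n|^-1 *: v n).
rewrite normrZ normfV normr_id mulVf ?gt_eqF // => /(_ (lexx _)).
rewrite dotZr -(sqnormE hdot) expr2 mulKf ?gt_eqF // normr_id => /le_trans; apply.
exact: ler_norm.
Qed.

(** The sum rule of Attouch and Brezis, at the proximal point: [x - p] splits into
    a subgradient of [g] and a subgradient of [h]. *)
Lemma sum_rule g h x : Gamma0 g -> Gamma0 h -> absorbing (edom g) (edom h) ->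
  exists p v, subgradient g p (x - p - v) /\ subgradient h p v.
Proof.
move=> Gg Gh abs.
pose l (n : nat) : R := n.+1%:R^-1.
have l0 n : 0 < l n by rewrite invr_gt0.
have l1 n : l n <= 1 by rewrite invf_le1 // ler1n.
have /choice[av avP] n : exists av : H * H, subgradient g av.1 (x - av.1 - av.2) /\
    subgradient h (av.1 - l n *: av.2) av.2.
  by have [a [v]] := yosida_solution x (l0 n) Gg Gh; exists (a, v).
pose a n := (av n).1; pose v n := (av n).2.
have sg n : subgradient g (a n) (x - a n - v n) by have [] := avP n.
have sh n : subgradient h (a n - l n *: v n) (v n) by have [] := avP n.
have [M hM] : exists M, forall n, `|v n| <= M.
  apply: dot_bounded => w; have [t [c [d [t0 gc hd orth]]]] := abs w.
  have [M hM] := yosida_bound x Gg Gh gc hd.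
  exists (t^-1 * M) => n; rewrite ler_pdivlMl //.
  have := orth _ _ (subgradient_dom (sg n)) (subgradient_dom (sh n)).
  rewrite subKr dotZl => /eqP; rewrite mulf_eq0 gt_eqF //= dotDr dotNr dotZr subr_eq0.
  by move=> /eqP ->; exact: (hM (l n) (a n) (v n)).
have M0 : 0 <= M by apply: le_trans (hM 0%N).
(* The sum of the two monotonicity inequalities between the parameters [l n] and
   [l k]. Dropping its left-hand side gives [vdist]; bounding its right-hand side
   gives the convergence of [a]. *)
have mono n k : `|a n - a k| ^+ 2 <=
    (l n + l k) * dot (v n) (v k) - l n * `|v n| ^+ 2 - l k * `|v k| ^+ 2.
  have := subgradient_monotone (sg n) (sg k); have := subgradient_monotone (sh n) (sh k).
  rewrite !(sqnormE hdot) !dotE ?(dotC dot (a k)) ?(dotC dot (v k) (a n)) ?(dotC dot (v k) (v n)).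
  by rewrite ?(dotC dot (v k) (a k)) ?(dotC dot (a n) (v n)) ?(dotC dot (a n) (v k)); lra.
have vdist n k : (n <= k)%N -> `|v n - v k| ^+ 2 <= `|v k| ^+ 2 - `|v n| ^+ 2.
  rewrite leq_eqVlt => /predU1P[->|nk]; first by rewrite !subrr normr0 expr0n.
  have lnk : l k < l n by rewrite ltf_pV2 ?posrE // ltr_nat.
  have := mono n k; have := sqr_ge0 `|a n - a k|; have := l0 k; have := l0 n.
  have : 0 <= `|v n - v k| ^+ 2 by rewrite sqr_ge0.
  rewrite !(sqnormE hdot (v _)) !(sqnormE hdot (v _ - v _)) !dotE ?(dotC dot (v k) (v n)).
  by nra.
pose s n := `|v n| ^+ 2.
have nds : nondecreasing_seq s.
  apply/nondecreasing_seqP => n; have := vdist _ _ (leqnSn n).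
  by have := sqr_ge0 `|v n - v n.+1|; rewrite /s; lra.
have cs : cvgn s.
  apply: nondecreasing_is_cvgn => //.
  by exists (M ^+ 2) => _ [n _ <-]; rewrite /s lerXn2r ?nnegrE.
have sS n : s n <= limn s by exact: nondecreasing_cvgn_le.
have /cvg_ex[V vV] : cvgn v.
  apply: (@cvg_of_sqdist _ _ _ (fun n => limn s - s n)).
    by rewrite -(subrr (limn s)); apply: cvgB => //; exact: cvg_cst.
  move=> n k; wlog nk : n k / (n <= k)%N => [W|].
    case/orP: (leq_total n k) => /W //.
    by rewrite distrC [X in _ -> _ <= X]addrC.
  apply: le_trans (vdist _ _ nk) _; rewrite -/(s n) -/(s k).
  by have := sS k; lra.
have l_cvg0 : l n @[n --> \oo] --> (0 : R) by exact: cvg_harmonic.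
have /cvg_ex[p ap] : cvgn a.
  apply: (@cvg_of_sqdist _ _ _ (fun n => l n * M ^+ 2)).
    by rewrite -(mul0r (M ^+ 2)); apply: cvgM => //; exact: cvg_cst.
  move=> n k; apply: le_trans (mono n k) _; rewrite -mulrDl.
  have : dot (v n) (v k) <= M ^+ 2.
    by apply: le_trans (dot_le hdot _ _) _; rewrite expr2 ler_pM.
  have ll : 0 < l n + l k by rewrite addr_gt0.
  rewrite -(ler_pM2l ll).
  have : 0 <= l n * `|v n| ^+ 2 by rewrite mulr_ge0 ?sqr_ge0 // ltW.
  have : 0 <= l k * `|v k| ^+ 2 by rewrite mulr_ge0 ?sqr_ge0 // ltW.
  by lra.
exists p, V; split.
  apply: (subgradient_closed hdot Gg ap _ sg).
  by apply: cvgB => //; apply: cvgB => //; exact: cvg_cst.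
apply: (subgradient_closed hdot Gh _ vV sh).
rewrite -[X in _ --> X]subr0 -(scale0r V).
by apply: cvgB => //; apply: cvgZ.
Qed.

End SumRule.

(** * Qualification conditions *)

Section Qualification.
Context (R : realType) (H : completeNormedModType R) (dot : {dot H for idfun}).
Hypothesis hdot : hilbert_norm dot.
Implicit Types (A B V : set H) (x y p u v w : H).

Lemma affine_hull_affine A : affine_set (affine_hull A).
Proof.
by move=> x y t Ax Ay M MA; apply: (proj1 MA); [exact: (Ax _ MA)|exact: (Ay _ MA)].
Qed.

Lemma sub_affine_hull A : A `<=` affine_hull A.
Proof. exact: sub_smallest. Qed.

(** A uniform range of steps [t] is recorded so that two such ranges, for two
    different sets, can be intersected. *)
Lemma near_segment (P : set H) p w : (\forall y \near p, P y) ->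
  exists2 t0 : R, 0 < t0 & forall t, 0 < t -> t <= t0 -> P (p + t *: w).
Proof.
move=> /nbhs_ballP[d /= d0 dP]; have w1 : 0 < `|w| + 1 by rewrite ltr_wpDl.
exists (d / (`|w| + 1)); first by rewrite divr_gt0.
move=> t t0; rewrite ler_pdivlMr // => tle; apply: dP.
rewrite -ball_normE /ball_ /= opprD addNKr normrN normrZ gtr0_norm //.
by apply: lt_le_trans tle; rewrite ltr_pM2l // ltrDl.
Qed.

Lemma rint_segment A p w : rint A p -> affine_hull A (p + w) ->
  exists2 t0 : R, 0 < t0 & forall t, 0 < t -> t <= t0 -> A (p + t *: w).
Proof.
move=> [Ap /near_segment-/(_ w)[t0 t0_gt0 seg]] Aw; exists t0 => // t t_gt0 tt0.
apply: seg => //.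
have -> : p + t *: w = t *: (p + w) + (1 - t) *: p.
  by apply: (dot_ext hdot) => z; rewrite !dotE; ring.
by apply: affine_hull_affine => //; exact: sub_affine_hull.
Qed.

Definition subspace V := V 0 /\ forall (k : R) u v, V u -> V v -> V (k *: u + v).

(** Orthogonal projection onto a subspace [V] contained in the span of a finite
    family. Induction on the family: [V] is the subspace [V'] of its elements that
    need only the first [n] vectors, extended by at most one vector [f], which can
    be taken orthogonal to [V'] by the induction hypothesis. *)
Lemma subspace_orthogonal_decomposition n (e : 'I_n -> H) V : subspace V ->
  (forall v, V v -> exists c : 'I_n -> R, v = \sum_(i < n) c i *: e i) ->
  forall w, exists2 w1, V w1 & forall u, V u -> dot u (w - w1) = 0.
Proof.
elim: n e V => [|n IHn] e V [V0 Vlin] Vspan w.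
  exists 0 => // u /Vspan[c ->]; rewrite big_ord0; exact: dot0l.
pose e' (i : 'I_n) := e (widen_ord (leqnSn n) i).
pose V' := V `&` [set v | exists c : 'I_n -> R, v = \sum_(i < n) c i *: e' i].
have V'lin : subspace V'.
  split.
    split=> //; exists (fun=> 0); rewrite big1 // => i _; exact: scale0r.
  move=> k u v [Vu [c uE]] [Vv [c' vE]]; split; first exact: Vlin.
  exists (fun i => k * c i + c' i); rewrite uE vE scaler_sumr -big_split /=.
  by apply: eq_bigr => i _; rewrite scalerA scalerDl.
have {}IHn := IHn e' V' V'lin (fun v => @proj2 _ _).
have [VV'|] := pselect (V `<=` V').
  have [w1 [Vw1 _] orth] := IHn w.
  by exists w1 => // u /VV'; exact: orth.
move=> /existsNP[g /not_implyP[Vg V'g]].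
have [g1 V'g1 orthg] := IHn g; have [w1 V'w1 orthw] := IHn w.
pose f := g - g1.
have VB u v : V u -> V v -> V (u - v).
  by move=> Vu Vv; rewrite -scaleN1r addrC; exact: Vlin.
have Vf : V f by apply: VB => //; case: V'g1.
have f0 : f != 0.
  by apply/eqP => /eqP; rewrite subr_eq0 => /eqP gg; apply: V'g; rewrite gg.
have ff : dot f f != 0.
  by rewrite -(sqnormE hdot) expf_eq0 /= normr_eq0.
(* As [f] is not in [V'], its last coefficient is invertible and can be used to
   eliminate the last vector of the family. *)
have [cf cfE] := Vspan _ Vf.
have cf0 : cf ord_max != 0.
  apply/eqP => cfm; apply: V'g; rewrite -(subrK g1 g) -/f addrC -[f]scale1r addrC.
  apply: (proj2 V'lin) => //; split=> //.
  exists (fun i => cf (widen_ord (leqnSn n) i)).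
  by rewrite cfE big_ord_recr /= cfm scale0r addr0.
have dec u : V u -> exists k : R, V' (u - k *: f).
  move=> Vu; have [cu cuE] := Vspan _ Vu.
  exists (cu ord_max / cf ord_max); split.
    by rewrite addrC -scaleNr; exact: Vlin.
  exists (fun i => cu (widen_ord (leqnSn n) i) -
                   cu ord_max / cf ord_max * cf (widen_ord (leqnSn n) i)).
  rewrite [in LHS]cuE [in LHS]cfE !big_ord_recr /= scalerDr scalerA divfK //.
  rewrite opprD addrACA subrr addr0 scaler_sumr -sumrB.
  by apply: eq_bigr => i _; rewrite scalerBl scalerA.
pose k := dot f w / dot f f.
exists (k *: f + w1); first by apply: Vlin => //; case: V'w1.
have fV' u : V' u -> dot f u = 0 by move=> /orthg; rewrite dotC.
move=> u /dec[r V'u]; rewrite -(subrK (r *: f) u) dotDl.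
have -> : w - (k *: f + w1) = (w - w1) - k *: f.
  by rewrite opprD addrA addrAC.
rewrite dotDr orthw // add0r dotNr dotZr (dotC dot _ f) fV' // mulr0 oppr0 add0r.
rewrite dotZl !dotDr !dotNr (fV' w1) // subr0 dotZr /k divfK //.
by rewrite subrr mulr0.
Qed.

Lemma absorbing_interior_r A B : A `&` interior B !=set0 -> absorbing dot A B.
Proof.
move=> [p [Ap Bp]] w; have [t t0 seg] := near_segment w Bp.
exists t, p, (p + t *: w); split=> //; first exact: seg.
by move=> a b _ _; rewrite addrAC subrr add0r subrr dot0r.
Qed.

Lemma absorbing_interior_l A B : B `&` interior A !=set0 -> absorbing dot A B.
Proof.
move=> [p [Bp Ap]] w; have [t t0 seg] := near_segment (- w) Ap.
exists t, (p + t *: - w), p; split=> //; first exact: seg.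
by move=> a b _ _; rewrite scalerN subKr subrr dot0r.
Qed.

(** With [p] in both relative interiors, [A - B] lies in the subspace [V] spanned by
    the directions of the two affine hulls. A direction [w] is replaced by its
    orthogonal projection on [V], which is a difference [s - s'] of directions of
    the two hulls; from [p], a small step along [s] stays in [B] and a small step
    along [s'] stays in [A]. *)
Lemma absorbing_rint A B : finite_dimensional H -> rint A `&` rint B !=set0 ->
  absorbing dot A B.
Proof.
move=> [n [e span]] [p [rA rB]] w.
pose V := [set v | exists s s', [/\ affine_hull B (p + s), affine_hull A (p + s') & v = s - s']].
have hA : affine_hull A p by apply: sub_affine_hull; case: rA.
have hB : affine_hull B p by apply: sub_affine_hull; case: rB.
have dir S (k : R) u v : affine_hull S p -> affine_hull S (p + u) -> affine_hull S (p + v) ->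
    affine_hull S (p + (k *: u + v)).
  move=> Sp Su Sv.
  (* An affine set is stable under affine combinations: go from [p] to
     [p + k u], take the midpoint with [p + v], and double its distance to [p]. *)
  have -> : p + (k *: u + v) =
      2 *: (2^-1 *: (k *: (p + u) + (1 - k) *: p) + (1 - 2^-1) *: (p + v))
      + (1 - 2) *: p.
    by apply: (dot_ext hdot) => z; rewrite !dotE; field.
  by do 3?[apply: affine_hull_affine => //].
have Vlin : subspace V.
  split; first by exists 0, 0; rewrite !addr0 subrr.
  move=> k _ _ [s [s' [Bs As' ->]]] [r [r' [Br Ar' ->]]].
  exists (k *: s + r), (k *: s' + r'); split; [exact: dir|exact: dir|].
  by apply: (dot_ext hdot) => z; rewrite !dotE; ring.
have [_ [s [s' [Bs As' ->]]] orth] :=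
  subspace_orthogonal_decomposition Vlin (fun v _ => span v) w.
have [t1 t1_gt0 segB] := rint_segment rB Bs.
have [t2 t2_gt0 segA] := rint_segment rA As'.
pose t := Num.min t1 t2.
have t0 : 0 < t by rewrite lt_min t1_gt0.
exists t, (p + t *: s'), (p + t *: s); split=> //.
- by apply: segA => //; rewrite ge_min lexx orbT.
- by apply: segB => //; rewrite ge_min lexx.
move=> a b Aa Bb.
have Vab : V (b - a).
  exists (b - p), (a - p); split.
  - by rewrite [_ + _]addrC subrK; apply: sub_affine_hull.
  - by rewrite [_ + _]addrC subrK; apply: sub_affine_hull.
  - by rewrite opprB addrA subrK.
have -> : t *: w - (p + t *: s - (p + t *: s')) = t *: (w - (s - s')).
  by apply: (dot_ext hdot) => z; rewrite !dotE; ring.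
by rewrite dotZr -opprB dotNl orth // oppr0 mulr0.
Qed.

End Qualification.

(** * The Douglas-Rachford iteration *)

Section DouglasRachford.
Context (R : realType) (H : completeNormedModType R) (dot : {dot H for idfun}).
Hypothesis hdot : hilbert_norm dot.

(** In terms of the displacements [w], [a], [b] of [z], [zh], [y] from the fixed
    point [p - kappa v], from [p] and from [p], monotonicity of [dg] and [dh] reads
    [<w - (1 + kappa) a, a> >= 0] and [<2 a - w - b, b> >= 0]. Their sum is
    [<w, a - b> >= |a - b|^2 + kappa |a|^2], from which the estimate follows by
    expanding [|w + t (b - a)|^2]. The parameter [kappa / (1 + kappa)] makes [zh]
    the resolvent of [kappa (dg + Id - x)] at [z]. *)
Lemma douglas_rachford_step g h (x p v z zh y : H) (kappa t : R) : Gamma0 g -> Gamma0 h ->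
  0 < kappa -> 0 <= t -> t <= 2 ->
  subgradient dot g p (x - p - v) -> subgradient dot h p v ->
  zh = prox (fun y => (kappa / (1 + kappa))%:E * g y)%E
         ((1 + kappa)^-1 *: (z + kappa *: x)) ->
  y = prox (fun y => kappa%:E * h y)%E (2 *: zh - z) ->
  `|z + t *: (y - zh) - (p - kappa *: v)| ^+ 2 <=
  `|z - (p - kappa *: v)| ^+ 2 - 2 * t * kappa * `|zh - p| ^+ 2.
Proof.
move=> Gg Gh k0 t0 t2 sg sh zhE yE.
have k10 : 0 < 1 + kappa by lra.
have m0 : 0 < kappa / (1 + kappa) by rewrite divr_gt0.
have := subgradient_monotone (prox_subgradient hdot (2 *: zh - z) (Gamma0_scale k0 Gh))
  (proj1 (subgradient_scale dot h p v k0) sh).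
have := subgradient_monotone (prox_subgradient hdot ((1 + kappa)^-1 *: (z + kappa *: x)) (Gamma0_scale m0 Gg))
  (proj1 (subgradient_scale dot g p _ m0) sg).
rewrite -zhE -yE.
pose w := z - (p - kappa *: v); pose a := zh - p; pose b := y - p.
have -> : (1 + kappa)^-1 *: (z + kappa *: x) - zh - (kappa / (1 + kappa)) *: (x - p - v)
    = (1 + kappa)^-1 *: (w - (1 + kappa) *: a).
  by apply: (dot_ext hdot) => q; rewrite /w /a !dotE; field; rewrite gt_eqF.
have -> : 2 *: zh - z - y - kappa *: v = 2 *: a - w - b.
  by apply: (dot_ext hdot) => q; rewrite /w /a /b !dotE; ring.
have -> : z + t *: (y - zh) - (p - kappa *: v) = w + t *: (b - a).
  by apply: (dot_ext hdot) => q; rewrite /w /a /b !dotE; ring.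
rewrite -/w -/a -/b dotZl pmulr_rge0 ?invr_gt0 // !(sqnormE hdot).
move: w a b => w a b; have := dot_ge0 dot (b - a).
rewrite !dotE (dotC dot b a) (dotC dot a w) (dotC dot b w) => sq le1 le2.
have : t * (t * (dot b b - 2 * dot a b + dot a a)) <=
    t * (2 * (dot b b - 2 * dot a b + dot a a)).
  by rewrite ler_wpM2l // ler_wpM2r //; lra.
have : 0 <= t * (dot w a - dot w b - (dot b b - 2 * dot a b + dot a a) - kappa * dot a a).
  by rewrite mulr_ge0 //; lra.
by lra.
Qed.

(** The increments of a nonincreasing nonnegative sequence tend to 0. *)
Lemma cvg_of_telescoping (D : nat -> R) (u : nat -> H) p (c : R) : 0 < c ->
  (forall m, 0 <= D m) -> (forall m, D m.+1 <= D m - c * `|u m - p| ^+ 2) ->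
  u m @[m --> \oo] --> p.
Proof.
move=> c0 D0 step.
have cD : cvgn D.
  apply: nonincreasing_is_cvgn; last by exists 0 => _ [n _ <-].
  apply/nonincreasing_seqP => n; apply: le_trans (step n) _.
  by rewrite gerBl mulr_ge0 ?sqr_ge0 // ltW.
have dD0 : D m - D m.+1 @[m --> \oo] --> (0 : R).
  by rewrite -(subrr (limn D)); apply: cvgB => //; rewrite (@cvg_shiftS _ D).
apply/cvgrPdist_lt => eps eps0.
have ce0 : 0 < c * eps ^+ 2 by rewrite mulr_gt0 ?exprn_gt0.
near=> m.
rewrite distrC -(@ltr_pXn2r _ 2) ?nnegrE ?normr_ge0 ?(ltW eps0) //.
rewrite -(ltr_pM2l c0); apply: (@le_lt_trans _ _ (D m - D m.+1)).
  by have := step m; lra.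
by near: m; exact: (cvgr_lt _ dD0).
Unshelve. all: by end_near. Qed.

End DouglasRachford.

Lemma relaxation_bounds (R : realType) (tau : nat -> R) :
  (0 < ereal_inf (range (fun m => (tau m)%:E)))%E ->
  (ereal_sup (range (fun m => (tau m)%:E)) <= 2%:E)%E ->
  exists2 t0 : R, 0 < t0 & forall m, t0 <= tau m /\ tau m <= 2.
Proof.
move=> inf_gt0 sup_le2.
have le_tau m : (ereal_inf (range (fun m => (tau m)%:E)) <= (tau m)%:E)%E.
  by apply: ereal_inf_lbound; exists m.
have tau_le m : tau m <= 2.
  by rewrite -lee_fin; apply: le_trans sup_le2; apply: ereal_sup_ubound; exists m.
move: inf_gt0 le_tau; case: ereal_inf => [r||] //.
  rewrite lte_fin => r0 le_tau; exists r => // m; split=> //.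
  by rewrite -lee_fin.
by move=> _ /(_ 0%N).
Qed.

Theorem proposition3p8 (R : realType) (H : completeNormedModType R)
    (dot : {dot H for idfun}) (hdot : hilbert_norm dot)
    (hsep : separable_space H)
    (C : set H) (hC0 : C !=set0) (hCcl : closed C) (hCcvx : convex_set C)
    (f : H -> \bar R) (hf : Gamma0 f)
    (gamma : R) (hgamma : 0 < gamma)
    (hqual :
      [\/ C `&` interior (edom f) !=set0,
          edom f `&` interior C !=set0
        | finite_dimensional H /\ rint C `&` rint (edom f) !=set0])
    (x : H) (kappa : R) (hkappa : 0 < kappa)
    (tau : nat -> R)
    (htau_inf : (0 < ereal_inf (range (fun m => (tau m)%:E)))%E)
    (htau_sup : (ereal_sup (range (fun m => (tau m)%:E)) <= 2%:E)%E)
    (z zhalf : nat -> H)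
    (hzhalf : forall m : nat,
      zhalf m = projection C ((1 + kappa)^-1 *: (z m + kappa *: x)))
    (hz : forall m : nat,
      z m.+1 = z m + tau m *:
        (prox (fun y => (kappa * gamma)%:E * f y)%E (2 *: zhalf m - z m)
         - zhalf m)) :
  (zhalf m @[m --> \oo] --> prox (fun y => indicator C y + gamma%:E * f y)%E x)
  /\
  (kappa = 1 ->
   z 0%N = 2 *: prox (fun y => gamma%:E * f y)%E x - x ->
   C (prox (fun y => gamma%:E * f y)%E x) ->
   forall m : nat,
     zhalf m = prox (fun y => indicator C y + gamma%:E * f y)%E x).
Proof.
have Gi := Gamma0_indicator hC0 hCcl hCcvx.
have Gf := Gamma0_scale hgamma hf.
set F := (fun y => gamma%:E * f y)%E in Gf *.
split.
- have domF : edom F = edom f.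
    apply/seteqP; split=> y; rewrite /edom /F /=; have [+ _ _ _] := hf => /(_ y);
      case: (f y) => [r||] //=; rewrite ?ltry // gt0_muley ?lte_fin // ltxx.
  have abs : absorbing dot (edom (indicator (R := R) C)) (edom F).
    rewrite edom_indicator domF; case: hqual => [q|q|[fin q]].
    + exact: absorbing_interior_r.
    + exact: absorbing_interior_l.
    + exact: absorbing_rint.
  have [p [v [sg sh]]] := sum_rule hdot x Gi Gf abs.
  (* The certificate [v] identifies [p] as the point to be reached. *)
  have -> : prox (fun y => indicator C y + F y)%E x = p.
    apply: (subgradient_prox hdot); rewrite -(subrK v (x - p)).
    exact: subgradientD.
  have [t0 t0_gt0 tauP] := relaxation_bounds htau_inf htau_sup.
  apply: (@cvg_of_telescoping _ _ (fun m => `|z m - (p - kappa *: v)| ^+ 2) _ _ (2 * t0 * kappa)).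
  + by rewrite !mulr_gt0.
  + by move=> m; exact: sqr_ge0.
  move=> m; have [t0m tm2] := tauP m.
  have tm0 : 0 <= tau m by apply: le_trans t0m; exact: ltW.
  have k10 : 0 < 1 + kappa by lra.
  have := douglas_rachford_step hdot Gi Gf hkappa tm0 tm2 sg sh (z := z m) (erefl _) (erefl _).
  (* An indicator is invariant under positive scaling, so its proximal map is the
     projection whatever the parameter. *)
  rewrite indicator_scale ?divr_gt0 // -projection_prox // -hzhalf /=.
  have -> : (fun y => kappa%:E * F y)%E = (fun y => (kappa * gamma)%:E * f y)%E.
    by apply/funext => y; rewrite /F muleA EFinM.
  rewrite -hz => /le_trans; apply; rewrite lerD2l lerN2.
  by rewrite ler_wpM2r ?sqr_ge0 // ler_pM2r // ler_pM2l.
- move=> k1 z0 Cq.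
  have sF := prox_subgradient hdot x Gf.
  set q := prox F x in z0 Cq sF *.
  have i0 : subgradient dot (indicator C) q 0.
    by apply/subgradient_indicatorP; split=> // y _; rewrite dot0l.
  have -> : prox (fun y => indicator C y + F y)%E x = q.
    by apply: (subgradient_prox hdot); rewrite -[x - q]add0r; exact: subgradientD.
  have projq : projection C q = q.
    by rewrite projection_prox //; apply: (subgradient_prox hdot); rewrite subrr.
  have half m : z m = z 0%N -> zhalf m = q.
    move=> zm; rewrite hzhalf zm z0 k1 scale1r subrK scalerA mulVf ?scale1r //.
  have fixz m : z m = z 0%N.
    elim: m => // m IH; rewrite hz (half m IH) IH z0 k1.
    by rewrite subKr mul1r -/F -/q subrr scaler0 addr0.
  by move=> m; apply: half.
Qed.
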